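(* Let $\mathcal{GR}$ be the Gray graph. Then $\mathcal{GR}$ is an essentially $4$-edge-connected cubic bipartite graph on $54$ vertices with girth $8$, it has exactly $10752$ $2$-factors, and the types of its $2$-factors are exactly $(54)$, $(18,18,18)$ and $(14,14,26)$. In particular, $\mathcal{GR}$ is pseudo $2$-factor isomorphic but not $2$-factor Hamiltonian, and hence it is an essentially $4$-edge-connected pseudo $2$-factor isomorphic cubic bipartite graph that is not isomorphic to $K_{3,3}$, the Heawood graph or the Pappus graph.
   Context: All graphs are finite and simple. The Gray graph $\mathcal{GR}$ is constructed as follows: take three disjoint copies of $K_{3,3}$; for each edge $e$ of $K_{3,3}$, subdivide the edge corresponding to $e$ in each of the three copies by one new vertex, and join the resulting three subdivision vertices to one further new vertex $v_e$. (So there are $18+27+9=54$ vertices.) A $2$-factor of a graph is a $2$-regular spanning subgraph, i.e. a set of disjoint cycles covering all vertices. The type of a $2$-factor is the tuple of the lengths of its cycles in increasing order. A graph is pseudo $2$-factor isomorphic if the numbers of cycles of all of its $2$-factors have the same parity. A graph is $2$-factor Hamiltonian if all of its $2$-factors are Hamiltonian cycles. A $3$-edge-cut of a cubic graph is trivial if it consists of the three edges incident with a vertex. A cubic graph is essentially $4$-edge-connected if it is $3$-connected and every $3$-edge-cut is trivial. The Heawood graph is the point-line incidence (Levi) graph of the Fano plane $PG(2,2)$ (14 vertices). The Pappus graph is the Levi graph of the Pappus $9_3$ configuration (18 vertices), i.e. the configuration obtained from the affine plane $AG(2,3)$ by deleting the three lines of one parallel class. *)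

(* Defs.v *)
From mathcomp Require Import all_boot all_order all_algebra.

Set Implicit Arguments.
Unset Strict Implicit.
Unset Printing Implicit Defensive.

Record sgraph := SGraph {
  vertex :> finType;
  adj : rel vertex;
  adj_sym : symmetric adj;
  adj_irrefl : irreflexive adj }.

Definition isomorphic (G H : sgraph) : Prop :=
  exists2 f : G -> H, bijective f & forall x y, adj (f x) (f y) = adj x y.

Definition edges (G : sgraph) : {set {set G}} :=
  [set [set p.1; p.2] | p : G * G & adj p.1 p.2].

Definition incident_edges (G : sgraph) (v : G) : {set {set G}} :=
  [set f in edges G | v \in f].

Definition neighbours (G : sgraph) (v : G) : {set G} := [set u | adj v u].

Definition cubic (G : sgraph) : Prop := forall v : G, #|neighbours v| = 3.

Definition bipartite (G : sgraph) : Prop :=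
  exists A : {set G}, forall x y, adj x y -> (x \in A) != (y \in A).

(* A cycle is given by the cyclic sequence of its vertices, or by its set of
   edges; its length is the size of either. *)

Definition cycle_seq (G : sgraph) (p : seq G) : bool :=
  (2 < size p) && ucycleb (@adj G) p.

Definition cycle_edges (G : sgraph) (p : seq G) : {set {set G}} :=
  [set [set x; next p x] | x in p].

(* The bound on the length is harmless: cycle_seq forbids repetitions, so the
   length is at most the number of vertices; see is_cycleP. *)
Definition is_cycle (G : sgraph) (C : {set {set G}}) : bool :=
  [exists n : 'I_#|G|.+1, [exists p : n.-tuple G,
    cycle_seq p && (C == cycle_edges p)]].

Lemma is_cycleP (G : sgraph) (C : {set {set G}}) :
  reflect (exists2 p, cycle_seq p & C = cycle_edges p) (is_cycle C).
Proof.
apply: (iffP existsP) => [[n /existsP[p /andP[cp /eqP->]]]|[p cp ->]].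
  by exists p.
have/andP[_ up] : ucycleb (@adj G) p by case/andP: cp.
have ltp : size p < #|G|.+1 by rewrite ltnS -(card_uniqP up) max_card.
exists (Ordinal ltp); apply/existsP; exists (in_tuple p).
by rewrite cp eqxx.
Qed.

Definition hamiltonian_cycle (G : sgraph) (C : {set {set G}}) : bool :=
  is_cycle C && (cover C == [set: G]).

Definition girth_is (G : sgraph) (g : nat) : Prop :=
  (exists2 p : seq G, cycle_seq p & size p = g) /\
  (forall p : seq G, cycle_seq p -> g <= size p).

Definition connected_without_vertices (G : sgraph) (S : {set G}) : Prop :=
  forall x y, x \notin S -> y \notin S ->
    connect [rel a b : G | [&& adj a b, a \notin S & b \notin S]] x y.

Definition k_connected (k : nat) (G : sgraph) : Prop :=
  k < #|G| /\
  forall S : {set G}, #|S| < k -> connected_without_vertices S.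

Definition connected_without_edges (G : sgraph) (S : {set {set G}}) : Prop :=
  forall x y, connect [rel a b : G | adj a b && ([set a; b] \notin S)] x y.

Definition k_edge_cut (k : nat) (G : sgraph) (S : {set {set G}}) : Prop :=
  [/\ S \subset edges G, #|S| = k & ~ connected_without_edges S].

Definition trivial_cut (G : sgraph) (S : {set {set G}}) : Prop :=
  exists v : G, S = incident_edges v.

Definition essentially_4_edge_connected (G : sgraph) : Prop :=
  k_connected 3 G /\
  forall S : {set {set G}}, k_edge_cut 3 S -> trivial_cut S.

(* A spanning subgraph is identified with its set of edges. *)

Definition two_factor (G : sgraph) (F : {set {set G}}) : bool :=
  (F \subset edges G) && [forall v : G, #|[set f in F | v \in f]| == 2].

Definition cycles_of (G : sgraph) (F : {set {set G}}) : {set {set {set G}}} :=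
  [set C : {set {set G}} | (C \subset F) && is_cycle C].

Definition factor_type (G : sgraph) (F : {set {set G}}) : seq nat :=
  sort leq [seq #|C : {set {set G}}| | C <- enum (cycles_of F)].

Definition pseudo_2factor_isomorphic (G : sgraph) : Prop :=
  forall F1 F2 : {set {set G}}, two_factor F1 -> two_factor F2 ->
    odd #|cycles_of F1| = odd #|cycles_of F2|.

Definition two_factor_hamiltonian (G : sgraph) : Prop :=
  forall F : {set {set G}}, two_factor F -> hamiltonian_cycle F.

Definition K33_vertex : finType := ('I_3 + 'I_3)%type.

Definition K33_adj : rel K33_vertex := fun x y =>
  match x, y with inl _, inr _ | inr _, inl _ => true | _, _ => false end.

Lemma K33_sym : symmetric K33_adj.
Proof. by move=> [?|?] [?|?]. Qed.

Lemma K33_irrefl : irreflexive K33_adj.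
Proof. by move=> [?|?]. Qed.

Definition K33 : sgraph := SGraph K33_sym K33_irrefl.

(* The pair (i, j) stands for the edge of K33 joining inl i and inr j. *)
Definition K33_edge : finType := ('I_3 * 'I_3)%type.

Definition K33_endpoint (x : K33_vertex) (e : K33_edge) : bool :=
  (x == inl e.1) || (x == inr e.2).

(* orig c x : the vertex x of the c-th copy of K33;
   subd c e : the vertex subdividing the edge e in the c-th copy;
   hub e    : the vertex v_e joined to the three subdivisions of e. *)
Definition gray_vertex : finType :=
  ('I_3 * K33_vertex + 'I_3 * K33_edge + K33_edge)%type.

Definition orig (c : 'I_3) (x : K33_vertex) : gray_vertex := inl (inl (c, x)).
Definition subd (c : 'I_3) (e : K33_edge) : gray_vertex := inl (inr (c, e)).
Definition hub (e : K33_edge) : gray_vertex := inr e.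

Definition gray_arc (u v : gray_vertex) : bool :=
  match u, v with
  | inl (inl (c, x)), inl (inr (c', e)) => (c == c') && K33_endpoint x e
  | inl (inr (_, e)), inr e' => e == e'
  | _, _ => false
  end.

Definition gray_adj : rel gray_vertex :=
  fun u v => gray_arc u v || gray_arc v u.

Lemma gray_sym : symmetric gray_adj.
Proof. by move=> u v; rewrite /gray_adj orbC. Qed.

Lemma gray_irrefl : irreflexive gray_adj.
Proof. by move=> [[[? ?]|[? ?]]|?]. Qed.

Definition Gray : sgraph := SGraph gray_sym gray_irrefl.

Section Levi.
Variables (P : finType) (L : {set {set P}}).

Definition levi_vertex : finType := (P + {l : {set P} | l \in L})%type.

Definition levi_adj : rel levi_vertex := fun u v =>
  match u, v with
  | inl p, inr l | inr l, inl p => p \in val l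
  | _, _ => false
  end.

Lemma levi_sym : symmetric levi_adj.
Proof. by move=> [?|?] [?|?]. Qed.

Lemma levi_irrefl : irreflexive levi_adj.
Proof. by move=> [?|?]. Qed.

Definition levi : sgraph := SGraph levi_sym levi_irrefl.
End Levi.

Import GRing.Theory.
Local Open Scope ring_scope.

(* Over F_2 a point of PG(2,2), i.e. a line of F_2^3 through 0, has a unique
   nonzero vector; a line is the set of points killed by a nonzero linear
   form. *)
Definition fano_point : finType := {x : 'rV['F_2]_3 | x != 0}.

Definition fano_line (a : fano_point) : {set fano_point} :=
  [set x : fano_point | val x *m (val a)^T == 0].

Definition fano_lines : {set {set fano_point}} :=
  [set fano_line a | a : fano_point].

Definition Heawood : sgraph := levi fano_lines.

Definition ag_point : finType := 'rV['F_3]_2.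

Definition ag_line (p d : ag_point) : {set ag_point} :=
  [set p + t *: d | t : 'F_3].

Definition ag_lines : {set {set ag_point}} :=
  [set ag_line q.1 q.2 | q : ag_point * ag_point & q.2 != 0].

(* The deleted parallel class consists of the lines of direction (0, 1);
   the choice is immaterial, GL_2(F_3) being transitive on directions. *)
Definition ag_parallel_class : {set {set ag_point}} :=
  [set ag_line p (delta_mx 0 1) | p : ag_point].

Definition pappus_lines : {set {set ag_point}} :=
  ag_lines :\: ag_parallel_class.

Definition Pappus : sgraph := levi pappus_lines.

(* Main.v *)
Require Import Defs.
From mathcomp Require Import all_boot all_order all_algebra.

(* The three neighbours of each vertex are numbered by ports, which turns every
   question into a small finite computation.
   A 2-factor is the complement of a perfect matching; a backtracking search
   with unit propagation finds the 10752 perfect matchings. For each of them,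
   walks leaving a hub are followed until they close up: when they visit every
   vertex and have 54 vertices in total they are disjoint, and in a 2-regular
   graph such a family consists of all the cycles.
   Both connectivity statements use 8-cycles only. If an edge e of a set S of
   three edges lies on an 8-cycle avoiding the rest of S, its ends stay
   connected without S; and the only pairs of edges meeting all the 8-cycles
   through e complete e to the star of one of its ends. In the same way, 8-cycles
   bypass one vertex, or two adjacent ones, when at most two are removed. *)

Set Implicit Arguments.
Unset Strict Implicit.
Unset Printing Implicit Defensive.

(** * Cycles of a 2-factor *)

Lemma set2_eqP (T : finType) (a b c d : T) :
  reflect ([set a; b] = [set c; d])
          ((a == c) && (b == d) || (a == d) && (b == c)).
Proof.
apply: (iffP orP) => [[/andP[/eqP-> /eqP->]|/andP[/eqP-> /eqP->]]|eq_abcd] //.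
  exact: setUC.
have: a \in [set c; d] by rewrite -eq_abcd set21.
have: b \in [set c; d] by rewrite -eq_abcd set22.
have: c \in [set a; b] by rewrite eq_abcd set21.
have: d \in [set a; b] by rewrite eq_abcd set22.
rewrite !inE => /orP[]/eqP ? /orP[]/eqP ? /orP[]/eqP ? /orP[]/eqP ?; subst;
  by rewrite ?eqxx; auto.
Qed.

Lemma in_edges (G : sgraph) (x y : G) : ([set x; y] \in edges G) = adj x y.
Proof.
apply/imsetP/idP => [[[a b]]|axy]; last by exists (x, y); rewrite ?inE.
rewrite inE /= => aab /set2_eqP/orP[]/andP[/eqP-> /eqP->] //.
by rewrite adj_sym.
Qed.

Section CyclesOfTwoFactor.
Variable G : sgraph.
Implicit Types (p q : seq G) (F C : {set {set G}}).

Lemma cycle_seq_uniq p : cycle_seq p -> uniq p.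
Proof. by case/andP=> _ /andP[]. Qed.

(** On two vertices [next] would be an involution. Excluding this makes the edges of a cycle
    pairwise distinct. *)
Lemma next_next_neq p x : uniq p -> 2 < size p -> x \in p ->
  next p (next p x) != x.
Proof.
move=> up sz xp; have [i s def_p] := rot_to xp.
have eq_next : next p =1 next (x :: s) by move=> y; rewrite -def_p next_rot.
have us : uniq (x :: s) by rewrite -def_p rot_uniq.
have: 2 < size (x :: s) by rewrite -def_p size_rot.
rewrite !eq_next; case: s us {def_p eq_next} => [|y [|z s]] //= /andP[].
rewrite !inE !negb_or => /and3P[xy xz _] _ _.
by rewrite !eqxx (eq_sym y) (negPf xy) ?eqxx eq_sym.
Qed.

Lemma cycle_edges_inj p : cycle_seq p ->
  {in p &, injective (fun x => [set x; next p x])}.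
Proof.
move=> cp x y xp yp /set2_eqP/orP[/andP[/eqP //]|/andP[/eqP xy /eqP yx]].
have [_ /andP[sz _]] := (cp, cp).
have := next_next_neq (cycle_seq_uniq cp) sz yp.
by rewrite -xy yx eqxx.
Qed.

Lemma card_cycle_edges p : cycle_seq p -> #|cycle_edges p| = size p.
Proof.
move=> cp; rewrite card_in_imset; last exact: cycle_edges_inj.
exact/card_uniqP/cycle_seq_uniq.
Qed.

Lemma cover_cycle_edges p : cover (cycle_edges p) = [set x in p].
Proof.
apply/setP=> x; rewrite inE; apply/bigcupP/idP => [[f]|xp]; last first.
  by exists [set x; next p x]; rewrite ?set21 //; apply/imsetP; exists x.
by case/imsetP=> y yp ->; rewrite !inE => /orP[]/eqP-> //; rewrite mem_next.
Qed.

(* Two edges of the cycle already exhaust the degree of [x] in [F]. *)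
Lemma cycle_edges_saturated F p f x : two_factor F -> cycle_seq p ->
  cycle_edges p \subset F -> x \in p -> f \in F -> x \in f ->
  f \in cycle_edges p.
Proof.
case/andP=> _ /forallP/(_ x)/eqP deg2 cp pF xp fF xf.
have up := cycle_seq_uniq cp.
have px : prev p x \in p by rewrite mem_prev.
pose A := [set [set x; next p x]; [set prev p x; next p (prev p x)]].
have AC : A \subset cycle_edges p.
  by apply/subsetP=> g; rewrite !inE => /orP[]/eqP->; apply/imsetP;
    [exists x | exists (prev p x)].
have cA : #|A| = 2.
  rewrite cards2 (_ : _ != _) //; apply/eqP=> /(cycle_edges_inj cp xp px) eqx.
  have [_ /andP[sz _]] := (cp, cp).
  have := next_next_neq up sz px; rewrite next_prev // -eqx.
  suff -> : next p x = x by rewrite eqxx.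
  by rewrite {1}eqx next_prev.
have sA : A \subset [set g in F | x \in g].
  apply/subsetP=> g gA; rewrite inE (subsetP pF) ?(subsetP AC) //=.
  by case/set2P: gA => ->; rewrite !inE ?next_prev // eqxx ?orbT.
have /eqP eA : A == [set g in F | x \in g] by rewrite eqEcard sA cA deg2.
by apply: (subsetP AC); rewrite eA inE fF.
Qed.

(** Starting at the common vertex [x], saturation of [q] puts each edge that [p] follows into [q],
    and with it the next vertex; the orbit of [x] under [next p] is all of [p]. *)
Lemma mem_cycle_edges_sub F p q x : two_factor F ->
  cycle_seq p -> cycle_edges p \subset F ->
  cycle_seq q -> cycle_edges q \subset F ->
  x \in p -> x \in q -> cycle_edges p \subset cycle_edges q.
Proof.
move=> FF cp pF cq qF xp xq.
have up := cycle_seq_uniq cp.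
have step y : y \in p -> y \in q -> [set y; next p y] \in cycle_edges q.
  move=> yp yq; apply: (cycle_edges_saturated FF cq qF yq); rewrite ?set21 //.
  by apply: (subsetP pF); apply/imsetP; exists y.
have stepq y : y \in p -> y \in q -> next p y \in q.
  move=> yp yq; have fq := step y yp yq.
  have: next p y \in cover (cycle_edges q).
    by apply/bigcupP; exists [set y; next p y]; rewrite ?set22.
  by rewrite cover_cycle_edges inE.
have sub y : y \in p -> y \in q.
  move=> yp; have fp : fcycle (next p) p by exact: cycle_next.
  have: fconnect (next p) x y.
    by rewrite (fconnect_cycle fp xp).
  move/iter_findex <-.
  elim: (findex _ _ _) => [|n IHn] //=.
  have: iter n (next p) x \in p.
    by elim: n {IHn} => //= n; rewrite mem_next.
  by move/stepq; apply.
by apply/subsetP=> f /imsetP[y yp ->]; exact: step (sub y yp).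
Qed.

(** Any cycle of [F] shares a vertex with a listed one, since the list covers all vertices;
    [mem_cycle_edges_sub], used both ways, then identifies their edge sets. *)
Lemma cycles_of_cover F (cs : seq (seq G)) : two_factor F ->
  all (@cycle_seq G) cs -> all (fun p => cycle_edges p \subset F) cs ->
  uniq (flatten cs) -> (forall x, x \in flatten cs) ->
  perm_eq (enum (cycles_of F)) [seq cycle_edges p | p <- cs].
Proof.
move=> FF /allP cyc /allP subF ucs cov; apply: uniq_perm.
- exact: enum_uniq.
(* Equal edge sets have equal covers, so two equal entries would share a vertex, against
   [uniq (flatten cs)]; this needs the sequences to be nonempty. *)
- have: all (fun p : seq G => 0 < size p) cs.
    by apply/allP=> p /cyc /andP[]; case: p.
  elim: cs cyc ucs {subF cov} => //= p cs IHcs cyc.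
  rewrite cat_uniq => /and3P[up pcs ucs] /andP[p0 cs0].
  rewrite IHcs ?andbT //; last by move=> q qcs; apply: cyc; rewrite inE qcs orbT.
  apply: contra pcs => /mapP[q qcs eqpq]; case: p p0 eqpq {up cyc} => // x p _.
  move=> eqpq; apply/hasP; exists x; last exact: mem_head.
  apply/flattenP; exists q => //; have := cover_cycle_edges q.
  by rewrite -eqpq cover_cycle_edges => /setP/(_ x); rewrite !inE eqxx.
move=> C; rewrite mem_enum inE; apply/andP/mapP => [[CF]|[p pcs ->]]; last first.
  split; first exact: subF.
  by apply/is_cycleP; exists p => //; apply: cyc.
case/is_cycleP=> q cq eqC; subst C.
have [x xq] : exists x, x \in q.
  by case: q cq {CF} => // x q _; exists x; rewrite mem_head.
have /flattenP[p pcs xp] := cov x.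
exists p => //; have [cp pF] := (cyc p pcs, subF p pcs).
apply/eqP; rewrite eqEsubset.
by rewrite (mem_cycle_edges_sub FF cq CF cp pF xq xp)
  (mem_cycle_edges_sub FF cp pF cq CF xp xq).
Qed.

Lemma factor_type_cover F (cs : seq (seq G)) : two_factor F ->
  all (@cycle_seq G) cs -> all (fun p => cycle_edges p \subset F) cs ->
  uniq (flatten cs) -> (forall x, x \in flatten cs) ->
  factor_type F = sort leq (map size cs).
Proof.
move=> FF cyc subF ucs cov; rewrite /factor_type.
have -> : map size cs = [seq #|C| | C <- [seq cycle_edges p | p <- cs]].
  rewrite -map_comp; apply/eq_in_map=> p pcs /=.
  by rewrite card_cycle_edges //; apply: (allP cyc).
apply/perm_sortP; [exact: leq_total|exact: leq_trans|exact: anti_leq|].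
exact/perm_map/cycles_of_cover.
Qed.

Lemma size_factor_type F : size (factor_type F) = #|cycles_of F|.
Proof. by rewrite size_sort size_map -cardE. Qed.

(** A Hamiltonian [F] is a cycle contained in itself, so a type without the entry [#|G|] refutes
    Hamiltonicity. *)
Lemma hamiltonian_factor_type F : hamiltonian_cycle F ->
  #|G| \in factor_type F.
Proof.
case/andP=> /[dup] cF /is_cycleP[p cp eqF]; rewrite {1}eqF cover_cycle_edges.
move/eqP=> allp; rewrite mem_sort; apply/mapP; exists F.
  by rewrite mem_enum inE subxx.
rewrite eqF card_cycle_edges // -(card_uniqP (cycle_seq_uniq cp)).
by apply: eq_card => x; have /setP/(_ x) := allp; rewrite !inE.
Qed.

End CyclesOfTwoFactor.

(** * Ports of the Gray graph *)

Definition i0 : 'I_3 := @Ordinal 3 0 isT.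
Definition i1 : 'I_3 := @Ordinal 3 1 isT.
Definition i2 : 'I_3 := @Ordinal 3 2 isT.
Definition I3 : seq 'I_3 := [:: i0; i1; i2].

(** Only the value of the ordinal is inspected, never its bound proof, so that ports evaluate
    directly. *)
Definition sel (A : Type) (i : 'I_3) (a b c : A) : A :=
  match nat_of_ord i with 0 => a | 1 => b | _ => c end.

Definition nbr (v : Gray) (q : 'I_3) : Gray :=
  match v with
  | inl (inl (c, inl i)) => subd c (i, q)
  | inl (inl (c, inr j)) => subd c (q, j)
  | inl (inr (c, (i, j))) => sel q (orig c (inl i)) (orig c (inr j)) (hub (i, j))
  | inr e => subd q e
  end.

(* The port of [nbr v q] leading back to [v]. *)
Definition back_port (v : Gray) (q : 'I_3) : 'I_3 :=
  match v with
  | inl (inl (_, inl _)) => i0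
  | inl (inl (_, inr _)) => i1
  | inl (inr (c, (i, j))) => sel q j i c
  | inr _ => i2
  end.

Definition nbrs (v : Gray) : seq Gray := [seq nbr v q | q <- I3].

Definition Gray_seq : seq Gray :=
  [seq hub (i, j) | i <- I3, j <- I3]
  ++ [seq orig c (inl i) | c <- I3, i <- I3]
  ++ [seq orig c (inr i) | c <- I3, i <- I3]
  ++ flatten [seq [seq subd c (i, j) | i <- I3, j <- I3] | c <- I3].

(* Differs from both arguments, or merely from [q] if they coincide. *)
Definition third (p q : 'I_3) : 'I_3 :=
  sel p (sel q i1 i2 i1) (sel q i2 i0 i0) (sel q i1 i0 i0).

Definition same3 (i j : 'I_3) : bool :=
  sel i (sel j true false false) (sel j false true false) (sel j false false true).

(** Equality by plain case analysis, used in the computations in place of the generic [==]; [sameE]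
    relates the two. *)
Definition same (v w : Gray) : bool :=
  match v, w with
  | inl (inl (c, inl i)), inl (inl (c', inl i')) => same3 c c' && same3 i i'
  | inl (inl (c, inr i)), inl (inl (c', inr i')) => same3 c c' && same3 i i'
  | inl (inr (c, (i, j))), inl (inr (c', (i', j'))) =>
      [&& same3 c c', same3 i i' & same3 j j']
  | inr (i, j), inr (i', j') => same3 i i' && same3 j j'
  | _, _ => false
  end.

Lemma ord3_ind (P : 'I_3 -> Prop) : P i0 -> P i1 -> P i2 -> forall i, P i.
Proof.
move=> P0 P1 P2 [[|[|[|//]]] lti].
- by rewrite (_ : Ordinal lti = i0) //; apply: val_inj.
- by rewrite (_ : Ordinal lti = i1) //; apply: val_inj.
- by rewrite (_ : Ordinal lti = i2) //; apply: val_inj.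
Qed.

Lemma mem_I3 i : i \in I3.
Proof. by elim/ord3_ind: i. Qed.

Lemma same3E i j : same3 i j = (i == j).
Proof. by elim/ord3_ind: i; elim/ord3_ind: j. Qed.

Lemma sameE v w : same v w = (v == w).
Proof.
case: v => [[[c [i|i]]|[c [i j]]]|[i j]];
  case: w => [[[c' [i'|i']]|[c' [i' j']]]|[i' j']];
  rewrite /= ?same3E; apply/idP/eqP=> //.
- by case/andP=> /eqP-> /eqP->.
- by case=> -> ->; rewrite !eqxx.
- by case/andP=> /eqP-> /eqP->.
- by case=> -> ->; rewrite !eqxx.
- by case/and3P=> /eqP-> /eqP-> /eqP->.
- by case=> -> -> ->; rewrite !eqxx.
- by case/andP=> /eqP-> /eqP->.
- by case=> -> ->; rewrite !eqxx.
Qed.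

Lemma mem_Gray_seq v : v \in Gray_seq.
Proof.
rewrite -has_pred1 -(eq_has (a1 := same v)); last first.
  by move=> w /=; rewrite sameE eq_sym.
case: v => [[[c [i|i]]|[c [i j]]]|[i j]]; elim/ord3_ind: i;
  by [elim/ord3_ind: c; try elim/ord3_ind: j | elim/ord3_ind: j].
Qed.

Lemma forall_GrayP (P : pred Gray) : reflect (forall v, P v) (all P Gray_seq).
Proof.
by apply: (iffP allP) => [PG v|PG v _]; [apply/PG/mem_Gray_seq|apply: PG].
Qed.

Lemma nbr_back v q : nbr (nbr v q) (back_port v q) = v.
Proof. by case: v => [[[c [i|i]]|[c [i j]]]|[i j]] //=; elim/ord3_ind: q. Qed.

Lemma back_port_back v q : back_port (nbr v q) (back_port v q) = q.
Proof. by case: v => [[[c [i|i]]|[c [i j]]]|[i j]] //=; elim/ord3_ind: q. Qed.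

Lemma adj_nbr v q : adj v (nbr v q).
Proof.
by case: v => [[[c [i|i]]|[c [i j]]]|[i j]]; elim/ord3_ind: q;
  rewrite /= /gray_adj /= /K33_endpoint /= ?eqxx ?orbT.
Qed.

Lemma nbr_inj v : injective (nbr v).
Proof.
by case: v => [[[c [i|i]]|[c [i j]]]|[i j]]; elim/ord3_ind => p;
  elim/ord3_ind: p.
Qed.

Lemma adj_nbrP v u : reflect (exists q, u = nbr v q) (adj v u).
Proof.
apply: (iffP idP) => [|[q ->]]; last exact: adj_nbr.
case: v => [[[c [i|i]]|[c [i j]]]|[i j]];
  case: u => [[[c' [i'|i']]|[c' [i' j']]]|[i' j']] //;
  rewrite /= /gray_adj /= /K33_endpoint ?orbF //=.
- by case/andP=> /eqP-> /eqP[->]; exists j'.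
- by case/andP=> /eqP-> /eqP[->]; exists i'.
- by case/andP=> /eqP-> /eqP[->]; exists i0.
- by case/andP=> /eqP-> /eqP[->]; exists i1.
- by move=> /eqP[-> ->]; exists i2.
- by move=> /eqP[-> ->]; exists c'.
Qed.

Lemma mem_nbrs v u : (u \in nbrs v) = adj v u.
Proof.
apply/mapP/adj_nbrP => [[q _]|[q]] ->; exists q => //; exact: mem_I3.
Qed.

Definition isin (v : Gray) (p : seq Gray) : bool := has (same v) p.

Lemma isinE v p : isin v p = (v \in p).
Proof.
by rewrite -has_pred1; apply: eq_has => w /=; rewrite sameE eq_sym.
Qed.

(** * Girth, degrees and orders *)

(** Only immediate returns are excluded, so vertices may repeat. Every repetition-free path is
    listed, which is what the girth argument uses. *)
Fixpoint nonbacktracking (n : nat) (p x : Gray) : seq (seq Gray) :=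
  if n isn't n'.+1 then [:: [::]] else
  flatten [seq [seq y :: s | s <- nonbacktracking n' x y]
          | y <- nbrs x & ~~ same y p].

(** A cycle of length [n + 2] through the arc from [x] to [y] has [n] further vertices, so the
    values 1 to 5 exclude the lengths 3 to 7. *)
Definition girth_check : bool :=
  all (fun x => all (fun y => all (fun n =>
    all (fun s => ~~ isin (last y s) (nbrs x)) (nonbacktracking n x y))
    [:: 1; 2; 3; 4; 5]) (nbrs x)) Gray_seq.

Lemma nonbacktrackingS n p x : nonbacktracking n.+1 p x =
  flatten [seq [seq y :: s | s <- nonbacktracking n x y]
          | y <- nbrs x & ~~ same y p].
Proof. by []. Qed.

Lemma nonbacktracking_path n p x s : s \in nonbacktracking n p x ->
  path (@adj Gray) x s.
Proof.
elim: n p x s => [|n IHn] p x s; first by rewrite inE => /eqP->.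
rewrite nonbacktrackingS => /flatten_mapP[y].
rewrite mem_filter mem_nbrs => /andP[_ xy].
by case/mapP=> t /IHn ht ->; apply/andP.
Qed.

Lemma mem_nonbacktracking p x s : path (@adj Gray) x s -> uniq [:: p, x & s] ->
  s \in nonbacktracking (size s) p x.
Proof.
elim: s p x => [|y s IHs] p x // /andP[xy ys] /andP[px /andP[xs us]].
rewrite nonbacktrackingS; apply/flatten_mapP; exists y.
  rewrite mem_filter mem_nbrs xy sameE andbT.
  by apply: contra px => /eqP->; rewrite !inE eqxx orbT.
by apply/map_f/IHs; rewrite //= xs us.
Qed.

Lemma girth_checked : girth_check.
Proof. by vm_cast_no_check (erefl true). Qed.

Lemma Gray_girth : girth_is Gray 8.
Proof.
split.
  (* The subdivision of a 4-cycle of one copy of [K33]. *)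
  exists [:: orig i0 (inl i0); subd i0 (i0, i0); orig i0 (inr i0); subd i0 (i1, i0);
             orig i0 (inl i1); subd i0 (i1, i1); orig i0 (inr i1); subd i0 (i0, i1)] => //.
case=> [|x [|y s]] //; rewrite /cycle_seq /ucycleb /= rcons_path.
case/and4P=> sz2 /and3P[xy ys sx] us1 us2; rewrite leqNgt.
apply/negP => sz7.
have /forall_GrayP/(_ x)/allP/(_ y) := girth_checked.
rewrite mem_nbrs => /(_ xy)/allP/(_ (size s)).
have -> : size s \in [:: 1; 2; 3; 4; 5].
  by case: s sz2 sz7 {ys sx us1 us2} => [|? [|? [|? [|? [|? [|]]]]]].
have mem_s : s \in nonbacktracking (size s) x y.
  by apply: mem_nonbacktracking => //; apply/andP.
move=> /(_ isT)/allP/(_ s mem_s).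
by rewrite isinE mem_nbrs adj_sym (sx : adj (last y s) x).
Qed.

Lemma Gray_cubic : cubic Gray.
Proof.
move=> v; rewrite -(card_ord 3) -(card_imset _ (@nbr_inj v)).
apply: eq_card => u; rewrite inE.
by apply/adj_nbrP/imsetP => [[q ->]|[q _ ->]]; exists q.
Qed.

Definition is_subd (v : Gray) : bool := if v is inl (inr _) then true else false.

Lemma adj_is_subd (x y : Gray) : adj x y -> is_subd x != is_subd y.
Proof. by case: x => [[[? ?]|[? ?]]|?]; case: y => [[[? ?]|[? ?]]|?]. Qed.

Lemma Gray_bipartite : bipartite Gray.
Proof. by exists [set v | is_subd v] => x y /adj_is_subd; rewrite !inE. Qed.

Lemma card_Gray : #|Gray| = 54.
Proof. by rewrite !card_sum !card_prod !card_sum !card_ord. Qed.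

(** * Separation from the three known graphs by the number of vertices *)

Lemma isomorphic_card G H : isomorphic G H -> #|G| = #|H|.
Proof. by case=> f /bij_eq_card. Qed.

(** The parametrisation [A] of the lines may repeat lines: a crude bound below 54 is enough. *)
Lemma card_levi_le (P : finType) (L : {set {set P}})
    (I : finType) (A : I -> {set P}) :
  (forall l, l \in L -> exists i, l = A i) -> #|levi L| <= #|P| + #|I|.
Proof.
move=> LA; rewrite card_sum leq_add2l card_sig.
rewrite -cardsT (leq_trans _ (leq_imset_card A _)) //.
apply/subset_leq_card/subsetP=> l; rewrite inE => /LA[i ->].
by apply/imsetP; exists i.
Qed.

Lemma Gray_not_K33 : ~ isomorphic Gray K33.
Proof. by move/isomorphic_card; rewrite card_Gray card_sum !card_ord. Qed.

Lemma Gray_not_Heawood : ~ isomorphic Gray Heawood.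
Proof.
move/isomorphic_card; rewrite card_Gray => eq54.
have le8 : #|fano_point| <= 8.
  rewrite card_sig (leq_trans (max_card _)) //.
  by rewrite card_mx card_Fp.
have: 54 <= #|fano_point| + #|fano_point|.
  by rewrite eq54; apply: card_levi_le => l /imsetP[a _ ->]; exists a.
by move/leq_trans/(_ (leq_add le8 le8)).
Qed.

Section PappusCard.
Import GRing.Theory.
Local Open Scope ring_scope.

Lemma ag_line_scale (p d : ag_point) (c : 'F_3) : c != 0 ->
  ag_line p (c *: d) = ag_line p d.
Proof.
move=> c0; apply/setP=> x; apply/imsetP/imsetP => [[t _ ->]|[t _ ->]].
  by exists (t * c); rewrite // scalerA.
by exists (t / c); rewrite // scalerA divfK.
Qed.

(** There are 9 points, and at most 27 lines: a line outside the deleted class has a direction with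
    nonzero first coordinate, which scales to [(1, m)], so a base point and a slope [m] describe
    it. *)
Lemma card_Pappus_le : (#|Pappus| <= 36)%N.
Proof.
have card9 : #|ag_point| = 9%N by rewrite card_mx card_Fp.
have -> : 36%N = (#|ag_point| + #|{: ag_point * 'F_3}|)%N.
  by rewrite card_prod card9 card_Fp.
pose dir (m : 'F_3) : ag_point := \row_j (if j == 0 then 1 else m).
apply: (@card_levi_le _ _ (ag_point * 'F_3)%type (fun q => ag_line q.1 (dir q.2))).
move=> l; rewrite inE => /andP[/negP notpar /imsetP[[p d]]].
rewrite inE /= => d0 eql; subst l.
have [d00|d00] := eqVneq (d 0 0) 0.
  case: notpar; apply/imsetP; exists p => //.
  have eqd : d = d 0 1 *: delta_mx 0 1.
    apply/rowP=> j; rewrite !mxE eqxx /=.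
    case: j => [[|[|//]] ltj].
      by rewrite (_ : Ordinal ltj = 0) ?d00 ?mulr0 //; apply: val_inj.
    by rewrite (_ : Ordinal ltj = 1) ?mulr1 //; apply: val_inj.
  rewrite eqd ag_line_scale //; apply: contraNneq d0 => d01.
  by rewrite eqd d01 scale0r.
exists (p, d 0 1 / d 0 0) => /=.
rewrite -(ag_line_scale _ (dir _) d00); congr ag_line.
apply/rowP=> j; rewrite !mxE; case: j => [[|[|//]] ltj].
  by rewrite (_ : Ordinal ltj = 0) ?mulr1 //; apply: val_inj.
rewrite (_ : Ordinal ltj = 1) /=; last exact: val_inj.
by rewrite mulrC divfK.
Qed.

End PappusCard.

Lemma Gray_not_Pappus : ~ isomorphic Gray Pappus.
Proof.
by move/isomorphic_card=> eq54; have := card_Pappus_le; rewrite -eq54 card_Gray.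
Qed.

(** * Connectivity *)

(* The walks [x1, ..., x6] completing [u, v] to a closed walk [u, v, x1, ..., x6]. *)
Definition octagons (u v : Gray) : seq (seq Gray) :=
  [seq s <- nonbacktracking 6 u v | isin (last v s) (nbrs u)].

Definition same_edge (e f : Gray * Gray) : bool :=
  same e.1 f.1 && same e.2 f.2 || same e.1 f.2 && same e.2 f.1.

Definition walk_edges (x : Gray) (s : seq Gray) : seq (Gray * Gray) :=
  pairmap pair x s.

(** Bounded search tree: a hitting set contains some edge of the first walk not yet met, and at most
    [n] edges are added to [acc]. *)
Fixpoint hitting_sets (n : nat) (ws : seq (seq (Gray * Gray)))
    (acc : seq (Gray * Gray)) : seq (seq (Gray * Gray)) :=
  match ws with
  | [::] => [:: acc]
  | w :: ws' =>
    if n isn't n'.+1 then [::] else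
    flatten [seq hitting_sets n' [seq t <- ws' | ~~ has (same_edge e) t] (e :: acc)
            | e <- w]
  end.

Definition detours (u v : Gray) : seq (seq (Gray * Gray)) :=
  [seq t <- [seq walk_edges v (rcons s u) | s <- octagons u v]
  | ~~ has (same_edge (u, v)) t].

(** The size test says that fewer than two further edges never meet all detours; hence a set found
    inside a set of three edges is the whole of it. *)
Definition cut_check_edge (u v : Gray) : bool :=
  all (fun S => (size S == 3) &&
         has (fun x => all (fun e => same x e.1 || same x e.2) S) [:: u; v])
    (hitting_sets 2 (detours u v) [:: (u, v)]).

Definition cut_check : bool :=
  all (fun u => all (cut_check_edge u) (nbrs u)) Gray_seq.

(** On an octagon with consecutive vertices [a], [w], [b], the five vertices of the other arc, read
    from [b] to [a]. *)
Definition interiors (w a b : Gray) : seq (seq Gray) :=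
  [seq behead s | s <- octagons a w & same (head w s) b].

Definition bypass_vertex_check_at (w a b : Gray) : bool :=
  same a b ||
    let ss := [seq s <- interiors w a b | ~~ isin w s] in
    all (fun z => [|| same z a, same z b | has (fun s => ~~ isin z s) ss]) Gray_seq.

Definition bypass_vertex_check : bool :=
  all (fun w => all (fun a => all (bypass_vertex_check_at w a) (nbrs w)) (nbrs w))
    Gray_seq.

(** On an octagon through [a], [w], [z], the arc begins with the other neighbour [b] of [z], and so
    leads from [b] to [a] when both ends of [wz] are removed. *)
Definition bypass_edge_check_at (w z a : Gray) : bool :=
  same a z ||
    let ss := [seq s <- interiors w a z | ~~ isin w s && ~~ isin z s] in
    all (fun b => same b w || has (fun s => same (head w s) b) ss) (nbrs z).

Definition bypass_edge_check : bool :=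
  all (fun w => all (fun z => all (bypass_edge_check_at w z) (nbrs w)) (nbrs w))
    Gray_seq.

Definition port_edge (v : Gray) (q : 'I_3) : {set Gray} := [set v; nbr v q].

Lemma port_edge_inj v : injective (port_edge v).
Proof.
move=> p q /set2_eqP/orP[/andP[_ /eqP/nbr_inj]|/andP[/eqP eqv _]] //.
by have := adj_nbr v q; rewrite -eqv adj_irrefl.
Qed.

Lemma port_edge_back v q : port_edge (nbr v q) (back_port v q) = port_edge v q.
Proof. by rewrite /port_edge nbr_back setUC. Qed.

Lemma incident_edgesE (v : Gray) : incident_edges v = [set port_edge v q | q : 'I_3].
Proof.
apply/setP=> f; rewrite inE; apply/andP/imsetP=> [[]|[q _ ->]]; last first.
  by rewrite in_edges adj_nbr set21.
case/imsetP=> [[a b]]; rewrite inE => ab -> /set2P[]->.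
  by have /adj_nbrP[q ->] := ab; exists q.
by move: ab; rewrite adj_sym => /adj_nbrP[q ->]; exists q; rewrite // setUC.
Qed.

Lemma card_incident_edges (v : Gray) : #|incident_edges v| = 3.
Proof. by rewrite incident_edgesE card_imset ?card_ord //; exact: port_edge_inj. Qed.

(** Walks of at most 7 edges from one hub reach every vertex. Giving the hub as its own predecessor
    forbids no first step, since it is not adjacent to itself. *)
Definition connected_check : bool :=
  let x := hub (i0, i0) in
  let ss := flatten [seq nonbacktracking n x x | n <- iota 0 8] in
  all (fun v => has (fun s => same (last x s) v) ss) Gray_seq.

Lemma connected_checked : connected_check.
Proof. by vm_cast_no_check (erefl true). Qed.

Lemma Gray_connected (x y : Gray) : connect (@adj Gray) x y.
Proof.
have root v : connect (@adj Gray) (hub (i0, i0)) v.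
  have /forall_GrayP/(_ v)/hasP[s] := connected_checked.
  case/flatten_mapP=> n _ /nonbacktracking_path ps.
  by rewrite sameE => /eqP<-; apply/connectP; exists s.
apply: connect_trans (root y); rewrite (sym_connect_sym (@adj_sym Gray)).
exact: root.
Qed.

Lemma octagons_path u v s : s \in octagons u v -> path (@adj Gray) v (rcons s u).
Proof.
rewrite mem_filter isinE mem_nbrs adj_sym rcons_path.
by case/andP=> -> /nonbacktracking_path->.
Qed.

Lemma interiors_path w a b t : t \in interiors w a b -> path (@adj Gray) b (rcons t a).
Proof.
case/mapP=> s; rewrite mem_filter sameE => /andP[/eqP<- /octagons_path ps ->].
by case: s ps => // y s /andP[].
Qed.

Lemma bypass_vertex_checked : bypass_vertex_check.
Proof. by vm_cast_no_check (erefl true). Qed.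

Lemma bypass_edge_checked : bypass_edge_check.
Proof. by vm_cast_no_check (erefl true). Qed.

Lemma bypass_vertex (w z a b : Gray) : adj w a -> adj w b -> a != b ->
    z != a -> z != b ->
  exists t, [/\ path (@adj Gray) b (rcons t a), w \notin t & z \notin t].
Proof.
rewrite -!mem_nbrs => wa wb ab za zb.
have /forall_GrayP/(_ w)/allP/(_ a wa)/allP/(_ b wb) := bypass_vertex_checked.
rewrite /bypass_vertex_check_at sameE (negPf ab) => /forall_GrayP/(_ z).
rewrite !sameE (negPf za) (negPf zb) => /hasP[t]; rewrite mem_filter !isinE.
by case/andP=> wt /interiors_path pt zt; exists t.
Qed.

Lemma bypass_edge (w z a b : Gray) : adj w z -> adj w a -> adj z b ->
    a != z -> b != w ->
  exists t, [/\ path (@adj Gray) b (rcons t a), w \notin t & z \notin t].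
Proof.
rewrite -!mem_nbrs => wz wa zb az bw.
have /forall_GrayP/(_ w)/allP/(_ z wz)/allP/(_ a wa) := bypass_edge_checked.
rewrite /bypass_edge_check_at sameE (negPf az) => /allP/(_ b zb).
rewrite sameE (negPf bw) => /hasP[s].
rewrite mem_filter !isinE sameE => /andP[/andP[ws zs] /interiors_path].
case: s ws zs => [|y t] ws zs; first by rewrite /= eq_sym (negPf bw).
move=> /andP[_ pt] /eqP eqb; rewrite -eqb; exists t; split=> //.
  by apply: contra ws; rewrite inE => ->; rewrite orbT.
by apply: contra zs; rewrite inE => ->; rewrite orbT.
Qed.

(** The choice [z = w] covers a singleton, so smaller removed sets need no separate treatment. *)
Lemma small_set_sub2 (T : finType) (S : {set T}) w : #|S| < 3 -> w \in S ->
  exists2 z, z \in S & S \subset [set w; z].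
Proof.
move=> S3 wS; have Sw1 : #|S :\ w| <= 1 by move: S3; rewrite (cardsD1 w) wS.
have [Sw0|[z Swz]] := set_0Vmem (S :\ w).
  by exists w => //; rewrite -(setD1K wS) Sw0 setU0 setUid.
exists z; first by case/setD1P: Swz.
rewrite -(setD1K wS) setUS //; apply/subsetP=> x Swx; rewrite inE.
by apply/eqP/(card_le1_eqP Sw1).
Qed.

Lemma connect_avoid (S : {set Gray}) x s : path (@adj Gray) x s ->
  {in x :: s, forall y, y \notin S} ->
  connect [rel a b : Gray | [&& adj a b, a \notin S & b \notin S]] x (last x s).
Proof.
move=> ps avoid; apply/connectP; exists s => //.
elim: s x ps avoid => // y s IHs x /andP[xy ys] avoid.
apply/andP; split.
  by rewrite /= [gray_adj _ _]xy !avoid // !inE eqxx ?orbT.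
by apply: IHs ys _ => z zs; apply: avoid; rewrite inE zs orbT.
Qed.

Lemma Gray_3_connected : k_connected 3 Gray.
Proof.
split=> [|S S3 x y xS yS]; first by rewrite card_Gray.
set e := (X in connect X).
have sym_e : symmetric e.
  by move=> a b; rewrite /e /= gray_sym [(a \notin S) && _]andbC.
have detour a b w z t : S \subset [set w; z] -> a \notin S -> b \notin S ->
    path (@adj Gray) b (rcons t a) -> w \notin t -> z \notin t -> connect e a b.
  move=> /subsetP Swz aS bS pt wt zt; rewrite (sym_connect_sym sym_e).
  have := connect_avoid pt; rewrite last_rcons; apply=> c.
  rewrite inE mem_rcons inE => /or3P[/eqP-> //|/eqP-> //|ct].
  by apply/negP=> /Swz /set2P[] eqc; rewrite -eqc ct in wt zt.
(* Invariant along a walk in the whole graph: at a removed vertex, all its surviving neighbours are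
   reachable instead of the vertex itself. *)
pose reached c := if c \in S then forall a, adj c a -> a \notin S -> connect e x a
                  else connect e x c.
suff reach p : path (@adj Gray) x p -> reached (last x p).
  have /connectP[p xp eqy] := Gray_connected x y.
  by have := reach p xp; rewrite -eqy /reached (negPf yS).
elim/last_ind: p => [|p w IHp]; first by rewrite /reached (negPf xS) connect0.
rewrite rcons_path last_rcons => /andP[/IHp]; move: (last x p) => z {IHp}.
rewrite /reached; case: ifPn => zS; case: ifPn => wS.
(* Two consecutive removed vertices are all of [S]: an octagon leads from another neighbour [b] of
   [z] to [a]. *)
- move=> reach_z zw a wa aS.
  have zwN : z != w by apply: contraTneq zw => ->; rewrite adj_irrefl.
  have Szw : S \subset [set w; z].
    have [z' z'S Sz'] := small_set_sub2 S3 wS.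
    have /set2P[eqzw|->//] := subsetP Sz' z zS.
    by rewrite eqzw eqxx in zwN.
  have [b zb bw] : exists2 b, adj z b & b != w.
    have [q0 eqw] := adj_nbrP _ _ zw.
    exists (nbr z (third q0 q0)); first exact: adj_nbr.
    by rewrite eqw (inj_eq (@nbr_inj z)); elim/ord3_ind: q0 {eqw}.
  have bS : b \notin S.
    apply: contra bw => /(subsetP Szw)/set2P[->//|eqb].
    by move: zb; rewrite eqb adj_irrefl.
  have az : a != z by apply: contraNneq aS => ->.
  have wz : adj w z by rewrite adj_sym.
  have [t [pt wt zt]] := bypass_edge wz wa zb az bw.
  apply: connect_trans (reach_z b zb bS) _.
  by rewrite (sym_connect_sym sym_e); apply: (detour a b w z t).
- by move=> reach_z zw; apply: reach_z.
(* Here [w] is removed and [z] is not: an octagon through [z], [w], [a] is followed the other way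
   round, avoiding the possible second removed vertex [z']. *)
- move=> reach_z zw a wa aS; apply: connect_trans reach_z _.
  have [->|za] := eqVneq z a; first exact: connect0.
  have [z' z'S Sz'] := small_set_sub2 S3 wS.
  have wz : adj w z by rewrite adj_sym.
  have z'z : z' != z by apply: contraNneq zS => <-.
  have z'a : z' != a by apply: contraNneq aS => <-.
  have [t [pt wt z't]] := bypass_vertex wz wa za z'z z'a.
  exact: (detour z a w z' t).
- move=> reach_z zw; apply: connect_trans reach_z (connect1 _).
  by rewrite /e /= [gray_adj _ _]zw zS.
Qed.

(** * Cuts of three edges *)

Definition edge_of (e : Gray * Gray) : {set Gray} := [set e.1; e.2].

Lemma same_edgeE e f : same_edge e f = (edge_of e == edge_of f).
Proof. by rewrite /same_edge !sameE; apply/set2_eqP/eqP. Qed.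

(** If [S] meets every walk, the search can always branch on an edge of [S]; this edge is new,
    because the remaining walks avoid [acc]. *)
Lemma hitting_setsP n ws acc (S : {set {set Gray}}) :
    (forall w, w \in ws -> has (fun e => edge_of e \in S) w) ->
    (forall w, w \in ws -> ~~ has (fun e => edge_of e \in map edge_of acc) w) ->
    uniq (map edge_of acc) -> {subset map edge_of acc <= S} ->
    #|S| <= size acc + n ->
  exists2 acc', acc' \in hitting_sets n ws acc &
    uniq (map edge_of acc') /\ {subset map edge_of acc' <= S}.
Proof.
elim: n ws acc => [|n IHn] [|w ws] acc hit new uacc accS leS;
  try by exists acc => //; apply: mem_head.
all: have /hasP[e ew eS] := hit w (mem_head _ _).
all: have e_new : edge_of e \notin map edge_of acc
       by apply: contra (new w (mem_head _ _)) => ?; apply/hasP; exists e.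
all: have uacc' : uniq (map edge_of (e :: acc)) by rewrite /= e_new.
all: have accS' : {subset map edge_of (e :: acc) <= S}
       by move=> f; rewrite inE => /predU1P[->|/accS].
  (* Without fuel, one more edge would give more than [#|S|] distinct edges inside [S]. *)
  have: size (map edge_of (e :: acc)) <= #|S|.
    by rewrite cardE; apply: uniq_leq_size => // f /accS'; rewrite mem_enum.
  by rewrite size_map => /leq_trans/(_ leS); rewrite addn0 ltnn.
pose ws' := [seq t <- ws | ~~ has (same_edge e) t].
have [|||acc' acc'in hacc'] := IHn ws' (e :: acc) _ _ uacc' accS' _.
- by move=> t; rewrite mem_filter => /andP[_ tws]; apply: hit; rewrite inE tws orbT.
- move=> t; rewrite mem_filter => /andP[te tws].
  apply/hasPn=> f ft; rewrite inE negb_or; apply/andP; split.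
    by apply: contra te => /eqP eqf; apply/hasP; exists f; rewrite // same_edgeE eqf.
  by have /hasPn/(_ f ft) := new t (mem_behead (s := w :: ws) tws).
- by rewrite /= addSnnS.
by exists acc' => //=; apply/flatten_mapP; exists e.
Qed.

Lemma cut_checked : cut_check.
Proof. by vm_cast_no_check (erefl true). Qed.

Lemma walk_edges_connect (S : {set {set Gray}}) x s : path (@adj Gray) x s ->
    ~~ has (fun e => edge_of e \in S) (walk_edges x s) ->
  connect [rel a b : Gray | adj a b && ([set a; b] \notin S)] x (last x s).
Proof.
move=> ps avoid; apply/connectP; exists s => //.
elim: s x ps avoid => // y s IHs x /andP[xy ys] /norP[xyS avoid].
by apply/andP; split; [apply/andP|apply: IHs].
Qed.

Lemma Gray_3_edge_cut (S : {set {set Gray}}) : k_edge_cut 3 S -> trivial_cut S.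
Proof.
case=> /subsetP SE card_S disc.
have [/existsP[v /eqP eqS]|/existsPn nontriv] :=
  boolP [exists v, S == incident_edges v]; first by exists v.
case: disc => x y; set e' := (X in connect X).
have sym_e' : symmetric e' by move=> a b; rewrite /e' /= gray_sym setUC.
(* It suffices to reconnect the ends of each edge. If those of an edge [uv] of [S] stay separated,
   [S] meets every detour of [uv], and the search finds a star inside [S]. *)
apply: connect_sub (Gray_connected x y) => u v uv.
have [uvS|uvS] := boolP ([set u; v] \in S); last first.
  by apply: connect1; rewrite /e' /= [gray_adj _ _]uv.
apply/negPn/negP=> disc.
have [||||| acc /= acc_hit [uacc accS]] := @hitting_setsP 2 (detours u v) [:: (u, v)] S.
- move=> w; rewrite mem_filter => /andP[_ /mapP[s /octagons_path ps ->]].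
  apply: contraR disc => /(walk_edges_connect ps).
  by rewrite last_rcons (sym_connect_sym sym_e').
- move=> w; rewrite mem_filter => /andP[uvw _]; apply: contra uvw.
  case/hasP=> f fw /predU1P[eqf|//]; apply/hasP; exists f => //.
  by rewrite same_edgeE eqf.
- by [].
- by move=> f /predU1P[->|].
- by rewrite card_S.
have vu : v \in nbrs u by rewrite mem_nbrs.
have /forall_GrayP/(_ u)/allP/(_ v vu)/allP/(_ acc acc_hit) := cut_checked.
case/andP=> /eqP sz /hasP[w _ /allP w_acc].
case/eqP: (nontriv w); apply/eqP; rewrite eqEcard card_incident_edges card_S andbT.
apply/subsetP=> f fS; rewrite inE SE //.
have /(uniq_min_size uacc)[|_ eq_acc] : {subset map edge_of acc <= enum S}.
- by move=> g /accS; rewrite mem_enum.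
- by rewrite -cardE card_S size_map sz.
have: f \in map edge_of acc by rewrite eq_acc mem_enum.
by case/mapP=> g /w_acc; rewrite !sameE => wg ->; rewrite !inE.
Qed.

Lemma Gray_essentially_4_edge_connected : essentially_4_edge_connected Gray.
Proof. by split; [exact: Gray_3_connected | exact: Gray_3_edge_cut]. Qed.

(** * Search for the perfect matchings *)

Inductive map3 (A : Type) := Map3 (a b c : A).
Definition get3 A (m : map3 A) (i : 'I_3) : A := let: Map3 a b c := m in sel i a b c.
Definition set3 A (m : map3 A) (i : 'I_3) (x : A) : map3 A :=
  let: Map3 a b c := m in sel i (Map3 x b c) (Map3 a x c) (Map3 a b x).
Definition const3 A (a : A) := Map3 a a a.

(** A table over the vertices as a tree of bounded depth, with branches for the left and right
    vertices of the copies, the subdivisions and the hubs; a lookup or an update follows a single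
    branch. *)
Inductive gray_map (A : Type) := GrayMap
  (l r : map3 (map3 A)) (s : map3 (map3 (map3 A))) (h : map3 (map3 A)).

Definition map_get A (m : gray_map A) (v : Gray) : A :=
  let: GrayMap l r s h := m in
  match v with
  | inl (inl (c, inl i)) => get3 (get3 l c) i
  | inl (inl (c, inr j)) => get3 (get3 r c) j
  | inl (inr (c, (i, j))) => get3 (get3 (get3 s c) i) j
  | inr (i, j) => get3 (get3 h i) j
  end.

Definition map_set A (m : gray_map A) (v : Gray) (a : A) : gray_map A :=
  let: GrayMap l r s h := m in
  match v with
  | inl (inl (c, inl i)) => GrayMap (set3 l c (set3 (get3 l c) i a)) r s h
  | inl (inl (c, inr j)) => GrayMap l (set3 r c (set3 (get3 r c) j a)) s h
  | inl (inr (c, (i, j))) =>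
    let sc := get3 s c in
    GrayMap l r (set3 s c (set3 sc i (set3 (get3 sc i) j a))) h
  | inr (i, j) => GrayMap l r s (set3 h i (set3 (get3 h i) j a))
  end.

Definition map_const A (a : A) : gray_map A :=
  let b := const3 (const3 a) in GrayMap b b (const3 b) b.

Lemma get3_set3 A (m : map3 A) i x j :
  get3 (set3 m i x) j = if i == j then x else get3 m j.
Proof. by case: m; elim/ord3_ind: i; elim/ord3_ind: j. Qed.

Lemma get_set A (m : gray_map A) v x w :
  map_get (map_set m v x) w = if v == w then x else map_get m w.
Proof.
by case: m => l r s h; case: v => [[[c [i|i]]|[c [i j]]]|[i j]];
  case: w => [[[c' [i'|i']]|[c' [i' j']]]|[i' j']];
  rewrite /= ?get3_set3 -?sameE /= ?same3E //;
  case: eqVneq => [->|] //=; rewrite ?get3_set3 //;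
  case: eqVneq => [->|] //=; rewrite get3_set3.
Qed.

Lemma get_const A (x : A) v : map_get (map_const x) v = x.
Proof.
case: v => [[[c [i|i]]|[c [i j]]]|[i j]]; elim/ord3_ind: i;
  by [elim/ord3_ind: c; try elim/ord3_ind: j | elim/ord3_ind: j].
Qed.

Notation partial_matching := (gray_map (option 'I_3)).

Definition assign (s : partial_matching) (v : Gray) (q : 'I_3) : partial_matching :=
  map_set (map_set s v (Some q)) (nbr v q) (Some (back_port v q)).

Definition covered (s : partial_matching) (v : Gray) : bool :=
  if map_get s v is Some _ then true else false.

Definition free_ports (s : partial_matching) (v : Gray) : seq 'I_3 :=
  [seq q <- I3 | ~~ covered s (nbr v q)].

(* [todo] lists the vertices that the last edge may have left with a single free
   neighbour. Out of fuel, the search returns an incomplete matching, which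
   [traced_type] rejects. *)
Fixpoint search (n : nat) (todo order : seq Gray) (s : partial_matching) :
    seq partial_matching :=
  if n isn't n'.+1 then [:: s] else
  match todo, order with
  | v :: todo', _ =>
    if covered s v then search n' todo' order s else
    match free_ports s v with
    | [::] => [::]
    | [:: q] => search n' (nbrs (nbr v q) ++ todo') order (assign s v q)
    | _ => search n' todo' order s
    end
  | [::], v :: order' =>
    if covered s v then search n' [::] order' s else
    flatten [seq search n' (nbrs v ++ nbrs (nbr v q)) order' (assign s v q)
            | q <- free_ports s v]
  | [::], [::] => [:: s]
  end.

(** The enumeration result holds for every order. Completing each row before the next serves
    propagation, and appending [Gray_seq] makes every vertex occur. *)
Definition search_order : seq Gray :=
  flatten [seq [seq hub (i, j) | j <- I3]
               ++ [seq subd c (i, j) | c <- I3, j <- I3] | i <- I3] ++ Gray_seq.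

Definition matchings : seq partial_matching :=
  search 500 [::] search_order (map_const None).

Definition complete (s : partial_matching) : bool := all (covered s) Gray_seq.

Definition port (s : partial_matching) (v : Gray) : 'I_3 := odflt i0 (map_get s v).

Notation port_function := {ffun Gray -> 'I_3}.
Implicit Types (s t : partial_matching) (m : port_function).

(* A perfect matching is given by the port of the matched edge at each vertex. *)
Definition is_matching (m : port_function) : bool :=
  [forall v, m (nbr v (m v)) == back_port v (m v)].

Definition extends (s : partial_matching) (m : port_function) : bool :=
  [forall v, map_get s v \in [:: None; Some (m v)]].

Definition extensions (s : partial_matching) : {set port_function} :=
  [set m | is_matching m & extends s m].

Lemma extendsP s m : reflect (forall v q, map_get s v = Some q -> m v = q) (extends s m).
Proof.
apply: (iffP forallP) => [sm v q sv|sm v].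
  by have := sm v; rewrite sv !inE => /eqP[].
by case sv: (map_get s v) => [q|]; rewrite !inE //= (sm v q sv) eqxx.
Qed.

Lemma matchingP m : reflect (forall v, m (nbr v (m v)) = back_port v (m v)) (is_matching m).
Proof. exact: eqfunP. Qed.

Definition coherent (s : partial_matching) : bool :=
  [forall v, forall q,
    (map_get s v == Some q) ==> (map_get s (nbr v q) == Some (back_port v q))].

Lemma coherentP s : reflect
  (forall v q, map_get s v = Some q -> map_get s (nbr v q) = Some (back_port v q))
  (coherent s).
Proof.
apply: (iffP forallP) => [coh v q sv|coh v].
  by apply/eqP; have /forallP/(_ q)/implyP := coh v; apply; apply/eqP.
by apply/forallP=> q; apply/implyP=> /eqP sv; apply/eqP/coh.
Qed.

Lemma coveredE s v : covered s v = (map_get s v != None).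
Proof. by rewrite /covered; case: (map_get s v). Qed.

Lemma get_assign s v q w : map_get (assign s v q) w =
  if nbr v q == w then Some (back_port v q)
  else if v == w then Some q else map_get s w.
Proof. by rewrite /assign !get_set. Qed.

Lemma coherent_assign s v q :
  coherent s -> ~~ covered s v -> ~~ covered s (nbr v q) ->
  coherent (assign s v q).
Proof.
rewrite !coveredE !negbK => /coherentP coh /eqP sv /eqP sq.
apply/coherentP=> w p; rewrite !get_assign.
have vq : nbr v q != v.
  by apply/eqP=> eqv; have := adj_nbr v q; rewrite eqv adj_irrefl.
case: eqVneq => [<- [<-]|qw].
  by rewrite nbr_back (negPf vq) eqxx back_port_back.
case: eqVneq => [<- [<-]|vw swp]; first by rewrite eqxx.
have := coh w p swp; case: eqVneq => [<-|_]; first by rewrite sq.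
by case: eqVneq => [<-|//]; rewrite sv.
Qed.

(** Were [nbr v q] already covered, a matching extending [s] with [m v = q] would force its recorded
    edge to lead back to [v], and coherence would cover [v]. *)
Lemma extensions_assign s v q m : coherent s -> ~~ covered s v ->
  (m \in extensions s) && (m v == q) =
  (q \in free_ports s v) && (m \in extensions (assign s v q)).
Proof.
move=> /coherentP coh; rewrite mem_filter mem_I3 andbT !inE !coveredE !negbK => /eqP sv.
have vq : nbr v q != v.
  by apply/eqP=> eqv; have := adj_nbr v q; rewrite eqv adj_irrefl.
apply/andP/and3P => [[/andP[mm /extendsP sm] /eqP mv]|[/eqP sq mm /extendsP sm]].
  have mq : m (nbr v q) = back_port v q by rewrite -{1}mv (matchingP _ mm) mv.
  split=> //.
    case sq: (map_get s (nbr v q)) => [p|//]; have := coh _ _ sq.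
    by rewrite -(sm _ _ sq) mq nbr_back sv.
  apply/extendsP=> w p; rewrite get_assign.
  by case: eqVneq => [<- [<-] //|_]; case: eqVneq => [<- [<-]|_ /sm].
have mv : m v = q.
  by apply: sm; rewrite get_assign (negPf vq) eqxx.
split; last by rewrite mv.
rewrite mm; apply/extendsP=> w p swp; apply: sm; rewrite get_assign.
case: eqVneq => [eqw|_]; first by rewrite -eqw sq in swp.
by case: eqVneq => [eqw|//]; rewrite -eqw sv in swp.
Qed.

Lemma sum_extensions_branch s v (f : port_function -> nat) :
  coherent s -> ~~ covered s v ->
  \sum_(m in extensions s) f m =
  \sum_(q <- free_ports s v) \sum_(m in extensions (assign s v q)) f m.
Proof.
move=> coh sv; rewrite (partition_big (fun m : {ffun _} => m v) xpredT) //=.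
have us : uniq (free_ports s v) by apply: filter_uniq.
rewrite (big_uniq _ us) /= [RHS]big_mkcond; apply: eq_bigr => q _.
under eq_bigl do rewrite extensions_assign //.
by case: ifP => // _; rewrite big_pred0.
Qed.

(** Dead ends and forced moves are branchings over zero or one free port, and skipped vertices leave
    [s] unchanged; so leaves and branchings are the only cases. *)
Lemma search_ind (P : partial_matching -> seq partial_matching -> Prop) :
    (forall s, coherent s -> P s [:: s]) ->
    (forall s v (L : 'I_3 -> seq partial_matching), coherent s -> ~~ covered s v ->
       {in free_ports s v, forall q, P (assign s v q) (L q)} ->
       P s (flatten [seq L q | q <- free_ports s v])) ->
  forall n todo order s, coherent s -> P s (search n todo order s).
Proof.
move=> P_leaf P_branch; elim=> [|n IHn] todo order s coh; first exact: P_leaf.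
have coh_assign v q : ~~ covered s v -> q \in free_ports s v -> coherent (assign s v q).
  by move=> sv; rewrite mem_filter => /andP[sq _]; apply: coherent_assign.
case: todo => [|v todo].
  case: order => [|v order]; first exact: P_leaf.
  rewrite [search _ _ _ _]/=; case: ifPn => sv; first exact: IHn.
  by apply: P_branch => // q /(coh_assign v q sv); apply: IHn.
rewrite [search _ _ _ _]/=; case: ifPn => sv; first exact: IHn.
case free: (free_ports s v) => [|q [|? ?]]; last exact: IHn.
  by have := P_branch s v (fun=> [::]) coh sv; rewrite free; apply.
set L := search _ _ _ _; have := P_branch s v (fun=> L) coh sv.
rewrite free /= cats0; apply=> p /[1!inE]/eqP->; apply: IHn.
by apply: coh_assign; rewrite ?free ?mem_head.
Qed.

(** Arbitrary weights serve two purposes: weight 1 counts the matchings, and the indicator of one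
    matching shows that it is listed. *)
Lemma sum_search n todo order s (f : port_function -> nat) : coherent s ->
  \sum_(m in extensions s) f m =
  \sum_(t <- search n todo order s) \sum_(m in extensions t) f m.
Proof.
move: s; apply: (search_ind (P := fun s L => \sum_(m in extensions s) f m =
  \sum_(t <- L) \sum_(m in extensions t) f m)) => [s _|s v L coh sv IH].
  by rewrite big_seq1.
rewrite big_flatten big_map (sum_extensions_branch f coh sv) big_seq [RHS]big_seq.
exact: eq_bigr.
Qed.

Lemma coherent_search n todo order s :
  coherent s -> all coherent (search n todo order s).
Proof.
move: s; apply: (search_ind (P := fun _ L => all coherent L)) => [s|s v L _ _ IH].
  by rewrite all_seq1.
elim: (free_ports s v) IH => //= q qs IHqs IH; rewrite all_cat IH ?mem_head //.
by apply: IHqs => p pqs; apply: IH; rewrite inE pqs orbT.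
Qed.

Definition port_fun (s : partial_matching) : port_function := [ffun v => port s v].

Lemma get_port s v : complete s -> map_get s v = Some (port s v).
Proof. by move/forall_GrayP/(_ v); rewrite /covered /port; case: (map_get s v). Qed.

Lemma port_fun_matching s : coherent s -> complete s -> is_matching (port_fun s).
Proof.
move=> /coherentP coh tot; apply/matchingP=> v; rewrite !ffunE.
by have := coh _ _ (get_port v tot); rewrite (get_port _ tot) => -[].
Qed.

Lemma extensions_complete s : coherent s -> complete s -> extensions s = [set port_fun s].
Proof.
move=> coh tot; apply/setP=> m; rewrite !inE; apply/andP/eqP => [[_ /extendsP sm]|->].
  by apply/ffunP=> v; rewrite ffunE; apply/sm/get_port.
split; first exact: port_fun_matching.
by apply/extendsP=> v q; rewrite ffunE (get_port v tot) => -[].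
Qed.

Lemma coherent_const : coherent (map_const None).
Proof. by apply/coherentP=> v q; rewrite get_const. Qed.

Lemma extensions_const : extensions (map_const None) = [set m | is_matching m].
Proof.
apply/setP=> m; rewrite !inE andbC (_ : extends _ _) //.
by apply/extendsP=> v q; rewrite get_const.
Qed.

(* Stated for an arbitrary list so that unification never evaluates the search. *)
Definition enumerates (L : seq partial_matching) : Prop :=
  all coherent L /\ forall f : port_function -> nat,
    \sum_(m | is_matching m) f m = \sum_(t <- L) \sum_(m in extensions t) f m.

Lemma search_enumerates n todo order : enumerates (search n todo order (map_const None)).
Proof.
split=> [|f]; first exact: coherent_search coherent_const.
rewrite -(sum_search n todo order f coherent_const).
by apply: eq_bigl => m; rewrite extensions_const inE.
Qed.

Section Enumeration.
Variable L : seq partial_matching.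
Hypotheses (enumL : enumerates L) (completeL : all complete L).

Lemma sum_is_matching (f : port_function -> nat) :
  \sum_(m | is_matching m) f m = \sum_(t <- L) f (port_fun t).
Proof.
case: enumL => coh ->; elim: L coh completeL => [|t M IHM]; first by rewrite !big_nil.
case/andP=> coh cohM /andP[com comM]; rewrite !big_cons IHM //.
by rewrite extensions_complete // big_set1.
Qed.

Lemma card_is_matching : #|[set m | is_matching m]| = size L.
Proof.
rewrite -sum1_card -sum1_size -(sum_is_matching (fun=> 1)).
by apply: eq_bigl => m; rewrite inE.
Qed.

(** The indicator of [m] has a positive sum over the matchings, hence over [L]. *)
Lemma has_port_fun m : is_matching m -> has (fun t => m == port_fun t) L.
Proof.
move=> mm; have := sum_is_matching (fun m' => m == m').
rewrite (bigD1 m mm) /= eqxx; apply: contra_eqT => no.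
suff -> : \sum_(t <- L) (m == port_fun t) = 0 by [].
elim: L no => [|t M IHM] no; first by rewrite big_nil.
by case/norP: no => /negPf mt no; rewrite big_cons mt IHM.
Qed.

End Enumeration.

(** * Cycle types *)

(* The vertices met from [v], entered through its port [p], until [stop]. *)
Fixpoint walk (n : nat) (s : partial_matching) (stop v : Gray) (p : 'I_3) : seq Gray :=
  if n isn't n'.+1 then [::] else
  if same v stop then [::] else
  let q := third p (port s v) in v :: walk n' s stop (nbr v q) (back_port v q).

(** With equal arguments [third] picks one of the two unmatched ports at [v]. The fuel 55 exceeds
    the number of vertices, so it allows even a Hamiltonian cycle to close. *)
Definition trace_step (s : partial_matching)
    (st : gray_map bool * seq (seq Gray)) (v : Gray) :=
  if map_get st.1 v then st else
  let q := third (port s v) (port s v) in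
  let p := v :: walk 55 s v (nbr v q) (back_port v q) in
  (foldl (fun marks x => map_set marks x true) st.1 p, p :: st.2).

Definition trace (s : partial_matching) :=
  foldl (trace_step s) (map_const false, [::]) [seq hub (i, j) | i <- I3, j <- I3].

Definition traced_type (s : partial_matching) : option (seq nat) :=
  let: (marks, cs) := trace s in
  if complete s && all (map_get marks) Gray_seq then Some (map size cs) else None.

(** Lengths come in the order of tracing, hence three arrangements of 14, 14, 26. The first three
    entries are the sorted types, whose occurrence is checked. *)
Definition known_types : seq (option (seq nat)) :=
  map Some [:: [:: 54]; [:: 18; 18; 18];
               [:: 14; 14; 26]; [:: 14; 26; 14]; [:: 26; 14; 14]].

Definition traced_types_check (L : seq partial_matching) : bool :=
  let ts := map traced_type L in
  [&& size ts == 10752, all (fun ty => ty \in known_types) ts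
    & all (fun ty => ty \in ts) (take 3 known_types)].

(** * Two-factors as complements of perfect matchings *)

Lemma port_edge_eq v p w q : port_edge v p = port_edge w q ->
  v = w /\ p = q \/ w = nbr v p /\ q = back_port v p.
Proof.
case/set2_eqP/orP=> /andP[/eqP eqv /eqP eqn].
  by left; split=> //; apply: (@nbr_inj v); rewrite eqn eqv.
right; split=> //; apply: (@nbr_inj w).
by rewrite -eqv -eqn nbr_back.
Qed.

Lemma edges_port_edge (f : {set Gray}) :
  f \in edges Gray -> exists v q, f = port_edge v q.
Proof.
case/imsetP=> [[v u]]; rewrite inE => /= vu ->.
by have /adj_nbrP[q ->] := vu; exists v, q.
Qed.

Definition factor_of m : {set {set Gray}} :=
  edges Gray :\: [set port_edge v (m v) | v : Gray].

Section FactorOf.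
Variables (m : port_function) (mm : is_matching m).

Lemma mem_factor_of v q : (port_edge v q \in factor_of m) = (q != m v).
Proof.
rewrite inE in_edges adj_nbr andbT; congr (~~ _).
apply/imsetP/eqP => [[w _ /port_edge_eq[[-> ->] //|[eqw eqq]]]|->]; last by exists v.
by have := matchingP _ mm w; rewrite eqq {1 2}eqw nbr_back back_port_back => ->.
Qed.

Lemma two_factor_factor_of : two_factor (factor_of m).
Proof.
apply/andP; split; first exact: subsetDl.
apply/forallP=> v; apply/eqP.
rewrite (_ : [set _ in _ | _] = port_edge v @: [set~ m v]); last first.
  apply/setP=> f; rewrite inE; apply/andP/imsetP => [[fF vf]|[q]]; last first.
    by rewrite in_setC1 => qm ->; rewrite mem_factor_of qm set21.
  have: f \in incident_edges v by rewrite inE vf; case/setDP: fF => ->.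
  rewrite incident_edgesE => /imsetP[q _ eqf]; exists q => //.
  by rewrite in_setC1 -mem_factor_of -eqf.
by rewrite card_imset ?cardsC1 ?card_ord //; apply: port_edge_inj.
Qed.

End FactorOf.

Lemma factor_of_inj : {in [set m | is_matching m] &, injective factor_of}.
Proof.
move=> m m'; rewrite !inE => mm mm' eqF; apply/ffunP=> v; apply/eqP.
by rewrite -[_ == _]negbK -mem_factor_of // -eqF mem_factor_of // eqxx.
Qed.

(** Each vertex has exactly one incident edge outside [F], and the port of this edge defines [m].
    That edge is missing from both of its ends, so [m] is a matching. *)
Lemma factor_of_surj (F : {set {set Gray}}) : two_factor F ->
  exists2 m, is_matching m & F = factor_of m.
Proof.
case/andP=> FE /forallP deg2.
have miss v : exists p, forall q, (port_edge v q \in F) = (q != p).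
  have: #|~: [set q | port_edge v q \in F]| == 1.
    have := cardsC [set q | port_edge v q \in F]; rewrite card_ord.
    suff -> : #|[set q | port_edge v q \in F]| = 2 by move=> /eqP; rewrite eqn_add2l.
    rewrite -(card_imset _ (@port_edge_inj v)); apply: etrans (eqP (deg2 v)).
    apply: eq_card => f; rewrite inE; apply/imsetP/andP => [[q]|[fF vf]].
      by rewrite inE => qF ->; rewrite set21.
    have: f \in incident_edges v by rewrite inE vf (subsetP FE).
    rewrite incident_edgesE => /imsetP[q _ eqf]; exists q => //.
    by rewrite inE -eqf.
  case/cards1P=> p /setP eqp; exists p => q.
  by have := eqp q; rewrite !inE => <-; rewrite negbK.
have [g gP] : exists g : Gray -> 'I_3, forall v q, (port_edge v q \in F) = (q != g v).
  (* By [miss] the default [i0] is never reached. *)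
  exists (fun v => odflt i0 [pick p | [forall q, (port_edge v q \in F) == (q != p)]]) => v.
  case: pickP => [p /forallP pP q|none]; first exact/eqP.
  by case: (miss v) => p pP; have /forallP[] := none p; move=> q; apply/eqP.
pose m : port_function := [ffun v => g v].
have mm : is_matching m.
  apply/matchingP=> v; rewrite !ffunE; apply/eqP; rewrite eq_sym -[_ == _]negbK.
  by rewrite -gP port_edge_back gP eqxx.
exists m => //; apply/setP=> f.
have [/edges_port_edge[v [q ->]]|fE] := boolP (f \in edges Gray).
  by rewrite mem_factor_of // gP ffunE.
by rewrite inE (negPf fE) andbF; apply: contraNF fE; apply: subsetP.
Qed.

Lemma card_two_factors :
  #|[set F : {set {set Gray}} | two_factor F]| = #|[set m | is_matching m]|.
Proof.
rewrite -(card_in_imset factor_of_inj); apply: eq_card => F; rewrite inE.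
apply/idP/imsetP => [/factor_of_surj[m mm ->]|[m]]; first by exists m; rewrite ?inE.
by rewrite inE => mm ->; apply: two_factor_factor_of.
Qed.

Lemma third_neq p q : third p q != q.
Proof. by elim/ord3_ind: p; elim/ord3_ind: q. Qed.

Lemma uniq_flatten_mem (T : eqType) (ss : seq (seq T)) p :
  uniq (flatten ss) -> p \in ss -> uniq p.
Proof.
elim: ss => //= q ss IHss; rewrite cat_uniq => /and3P[uq _ uss].
by case/predU1P=> [->|/(IHss uss)].
Qed.

Lemma map_get_marks (p : seq Gray) (marks : gray_map bool) v :
  map_get (foldl (fun marks x => map_set marks x true) marks p) v =
  (v \in p) || map_get marks v.
Proof.
elim: p marks => //= x p IHp marks; rewrite IHp get_set inE eq_sym.
by case: eqVneq => //= _; rewrite orbT.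
Qed.

(** * Correctness of the traced cycles *)

Section Trace.
Variables (s : partial_matching) (coh : coherent s) (com : complete s).
Let F := factor_of (port_fun s).
Let e : rel Gray := fun x y => [set x; y] \in F.
Let mm := port_fun_matching coh com.

(** A walk shorter than its fuel ended because it met [stop]. *)
Lemma walk_path n stop x v p : size (walk n s stop v p) < n -> e x v ->
  path e x (rcons (walk n s stop v p) stop).
Proof.
elim: n x v p => // n IHn x v p; rewrite [walk _ _ _ _ _]/= sameE.
have [-> _ xs|_ szw xv] := eqVneq v stop; first by rewrite /= xs.
rewrite rcons_cons; apply/andP; split=> //; apply: IHn => //.
by rewrite /e /F -/(port_edge v _) mem_factor_of // ffunE third_neq.
Qed.

(** The bound 55 on [v :: walk] says that the walk took fewer than 55 steps, as [walk_path]
    requires. Distinctness of the vertices is left to a count at the end. *)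
Definition trace_inv (st : gray_map bool * seq (seq Gray)) : Prop :=
  (forall v, map_get st.1 v -> v \in flatten st.2) /\
  {in st.2, forall p, size p <= 55 -> cycle e p}.

Lemma trace_step_inv st v : trace_inv st -> trace_inv (trace_step s st v).
Proof.
rewrite /trace_step; case: (map_get st.1 v) => // -[marked cyc].
have := @walk_path 55 v v (nbr v (third (port s v) (port s v)))
  (back_port v (third (port s v) (port s v))).
move: (walk _ _ _ _ _) => w pw; split.
  move=> x; rewrite map_get_marks -[flatten _]/((v :: w) ++ flatten st.2) mem_cat.
  by case/orP=> [->|/marked->]; rewrite ?orbT.
move=> p /predU1P[->|/cyc//] szw; apply: pw => //.
by rewrite /e /F -/(port_edge v _) mem_factor_of // ffunE third_neq.
Qed.

Lemma traceP : trace_inv (trace s).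
Proof.
rewrite /trace; have: trace_inv (map_const false, [::]).
  by split=> // v; rewrite get_const.
by elim: [seq _ | _ <- _, _ <- _] (_, _) => //= v vs IHvs st /(trace_step_inv v)/IHvs.
Qed.

(** The traced sequences cover the 54 vertices with total length 54, so no vertex repeats; they are
    then disjoint cycles covering the graph, and [factor_type_cover] applies. *)
Lemma traced_factor_type ty : traced_type s = Some ty ->
  sumn ty = 54 -> all (leq 3) ty -> factor_type F = sort leq ty.
Proof.
rewrite /traced_type; case: (trace s) traceP => marks cs [marksP cycP].
rewrite com andTb; case: forall_GrayP => // all_marked [<-] sum54 /allP ge3.
have cov v : v \in flatten cs by apply/marksP/all_marked.
have ucs : uniq (flatten cs).
  apply: (leq_size_uniq (enum_uniq Gray)) => [v _|]; first exact: cov.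
  by rewrite -cardE card_Gray size_flatten -/(map size cs) /shape sum54.
have sz_le p : p \in cs -> size p <= 55.
  move=> pcs; apply: (@leq_trans 54) => //; rewrite -sum54.
  by elim: cs pcs {cov ucs marksP cycP sum54 ge3} => //= q cs IHcs /predU1P[->|/IHcs];
    rewrite ?leq_addr // => /leq_trans; apply; rewrite leq_addl.
have cyc p : p \in cs -> cycle e p by move=> pcs; apply: cycP (sz_le p pcs).
have FF : two_factor F by apply: two_factor_factor_of.
apply: factor_type_cover => //; apply/allP=> p pcs.
  rewrite /cycle_seq /ucycleb (uniq_flatten_mem ucs pcs) andbT.
  rewrite (ge3 (size p)) ?map_f //=.
  apply: sub_cycle (cyc p pcs) => x y; case/andP: FF => /subsetP FE _.
  by move/FE; rewrite in_edges.
by apply/subsetP=> f /imsetP[x xp ->]; apply: next_cycle (cyc p pcs) xp.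
Qed.

End Trace.

Definition gray_types : seq (seq nat) := [:: [:: 54]; [:: 18; 18; 18]; [:: 14; 14; 26]].

Lemma all_has_ex (T : Type) (a b : pred T) (L : seq T) : all a L -> has b L ->
  exists x, a x /\ b x.
Proof.
elim: L => //= x L IHL /andP[ax aL] /orP[bx|bL]; first by exists x.
exact: IHL.
Qed.

Lemma traced_type_complete t : traced_type t \in known_types -> complete t.
Proof.
by rewrite /traced_type; case: (trace t) => marks cs; case: (complete t).
Qed.

Lemma known_factor_type t : coherent t -> traced_type t \in known_types ->
  Some (factor_type (factor_of (port_fun t))) = omap (sort leq) (traced_type t).
Proof.
move=> coh known; have com := traced_type_complete known.
case/mapP: known => ty ty_known eq_ty; rewrite eq_ty /=.
by rewrite (traced_factor_type coh com eq_ty); move: ty_known; rewrite !inE;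
  do ?[case/predU1P=> [->|] //]; move/eqP->.
Qed.

Section TypesOfTwoFactors.
Variable L : seq partial_matching.
Hypotheses (enumL : enumerates L) (checkL : traced_types_check L).

Let check : [&& size (map traced_type L) == 10752,
  all (fun ty => ty \in known_types) (map traced_type L) &
  all (fun ty => ty \in map traced_type L) (take 3 known_types)].
Proof. exact: checkL. Qed.

Let knownL : all (fun t => coherent t && (traced_type t \in known_types)) L.
Proof.
case/and3P: check => _; rewrite all_map => known _; rewrite all_predI known andbT.
by case: enumL.
Qed.

Let completeL : all complete L.
Proof. by apply: sub_all knownL => t /andP[_ /traced_type_complete]. Qed.

Lemma card_two_factors_L : #|[set F : {set {set Gray}} | two_factor F]| = 10752.
Proof.
rewrite card_two_factors (card_is_matching enumL completeL).
by case/and3P: check => /eqP; rewrite size_map.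
Qed.

Lemma factor_type_L (F : {set {set Gray}}) :
  two_factor F -> factor_type F \in gray_types.
Proof.
case/factor_of_surj=> m mm ->.
have hasL := has_port_fun enumL completeL mm.
have [t [/andP[coh known] /eqP->]] := all_has_ex knownL hasL.
have := known_factor_type coh known; case/mapP: known => ty ty_known -> [->].
by move: ty_known; rewrite !inE; do ?[case/predU1P=> [->|] //]; move/eqP->.
Qed.

Lemma exists_factor_type_L ty : ty \in gray_types ->
  exists2 F : {set {set Gray}}, two_factor F & factor_type F = ty.
Proof.
move=> tyG; case/and3P: check => _ _ /allP/(_ (Some ty)).
rewrite (_ : _ \in take 3 _); last exact: (map_f Some tyG).
move=> /(_ isT); rewrite -has_pred1 has_map.
case/(all_has_ex knownL)=> t [/andP[coh known] /eqP eq_ty].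
have com := traced_type_complete known.
exists (factor_of (port_fun t)); first exact/two_factor_factor_of/port_fun_matching.
have := known_factor_type coh known; rewrite eq_ty => -[->].
by move: tyG; rewrite !inE; do ?[case/predU1P=> [->|] //]; move/eqP->.
Qed.

End TypesOfTwoFactors.

Lemma matchings_enumerates : enumerates matchings.
Proof. exact (search_enumerates _ _ _). Qed.

Lemma traced_types_checked : traced_types_check matchings.
Proof. by vm_cast_no_check (erefl true). Qed.

Lemma Gray_factor_type (F : {set {set Gray}}) :
  two_factor F -> factor_type F \in gray_types.
Proof. exact (@factor_type_L _ matchings_enumerates traced_types_checked F). Qed.

Lemma Gray_exists_factor_type ty : ty \in gray_types ->
  exists2 F : {set {set Gray}}, two_factor F & factor_type F = ty.
Proof. exact (@exists_factor_type_L _ matchings_enumerates traced_types_checked ty). Qed.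

Theorem mainTheorem1 :
  [/\ essentially_4_edge_connected Gray, cubic Gray, bipartite Gray,
      #|Gray| = 54 & girth_is Gray 8] /\
  #|[set F : {set {set Gray}} | two_factor F]| = 10752 /\
  (forall t : seq nat,
     (exists2 F : {set {set Gray}}, two_factor F & factor_type F = t) <->
     t \in [:: [:: 54]; [:: 18; 18; 18]; [:: 14; 14; 26]]) /\
  pseudo_2factor_isomorphic Gray /\
  ~ two_factor_hamiltonian Gray /\
  [/\ ~ isomorphic Gray K33, ~ isomorphic Gray Heawood
    & ~ isomorphic Gray Pappus].
Proof.
split; first split.
- exact: Gray_essentially_4_edge_connected.
- exact: Gray_cubic.
- exact: Gray_bipartite.
- exact: card_Gray.
- exact: Gray_girth.
split; first exact (card_two_factors_L matchings_enumerates traced_types_checked).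
split.
  by move=> t; split=> [[F /Gray_factor_type FG <-]|/Gray_exists_factor_type].
split.
  (* Each of the three types has one or three entries. *)
  have odd_cycles (F : {set {set Gray}}) : two_factor F -> odd #|cycles_of F|.
    rewrite -size_factor_type => /Gray_factor_type.
    by rewrite !inE => /or3P[]/eqP->.
  by move=> F1 F2 /odd_cycles-> /odd_cycles->.
split; last first.
  by split; [exact: Gray_not_K33|exact: Gray_not_Heawood|exact: Gray_not_Pappus].
(* A Hamiltonian 2-factor has the entry 54 in its type, which this one lacks. *)
move=> ham; have [F FF eqF] := @Gray_exists_factor_type [:: 18; 18; 18] isT.
by have := hamiltonian_factor_type (ham F FF); rewrite eqF card_Gray.
Qed.
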